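(* Let $d\ge 1$ and $k\ge 2$ be fixed integers and let $\varepsilon>0$ and $C>0$ be fixed. Let $q$ be a power of an odd prime, let $E\subseteq\mathbb F_q^d$, and let $\alpha=(\alpha_1,\dots,\alpha_k)\in\mathbb F_q^k$. Suppose that at least one of the following holds: (i) $|E|\ge C q^{\varepsilon}\, q^{\frac{d+k}{2}}$; (ii) all components $\alpha_1,\dots,\alpha_k$ are nonzero and $|E|\ge C q^{\varepsilon}\, q^{\frac{d+k-1}{2}}$. Then $$|\Pi_\alpha(E)|=(1+o(1))\frac{|E|^{k+1}}{q^k},$$ where $o(1)$ denotes a quantity tending to $0$ as $q\to\infty$ (with $d,k,\varepsilon,C$ fixed), uniformly over all such $E$ and $\alpha$.
   Context: $\mathbb F_q$ is the finite field with $q$ elements, and $x\cdot y=\sum_{i=1}^d x_iy_i\in\mathbb F_q$ for $x,y\in\mathbb F_q^d$. For a sequence $\alpha=(\alpha_1,\dots,\alpha_k)$ of elements of $\mathbb F_q$, a dot product $k$-chain (of type $\alpha$) is a $(k+1)$-tuple of distinct points $(x_1,\dots,x_{k+1})$ with $x_j\cdot x_{j+1}=\alpha_j$ for every $1\le j\le k$. For $E\subseteq\mathbb F_q^d$, $\Pi_\alpha(E)$ is the set of dot product $k$-chains of type $\alpha$ all of whose points lie in $E$. Throughout, $k$ is treated as a constant. *)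

(* Defs.v *)
From HB Require Import structures.
From mathcomp Require Import all_boot all_order all_algebra.
From mathcomp Require Import all_classical all_reals all_analysis.

Set Implicit Arguments.
Unset Strict Implicit.
Unset Printing Implicit Defensive.

Import Order.TTheory GRing.Theory Num.Theory.
Import numFieldNormedType.Exports.

Local Open Scope ring_scope.

Definition dotprod (F : finFieldType) (d : nat) (x y : 'rV[F]_d) : F :=
  \sum_(i < d) x 0 i * y 0 i.

(* Indices are shifted to start at 0: the points are x`_0, ..., x`_k and the
   prescribed dot products are tnth alpha 0, ..., tnth alpha (k - 1). *)
Definition dotprod_chain (F : finFieldType) (d k : nat) (alpha : k.-tuple F)
    (x : k.+1.-tuple 'rV[F]_d) : bool :=
  uniq x && [forall j : 'I_k, dotprod x`_j x`_j.+1 == tnth alpha j].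

Definition chains_in (F : finFieldType) (d k : nat) (alpha : k.-tuple F)
    (E : {set 'rV[F]_d}) : {set k.+1.-tuple 'rV[F]_d} :=
  [set x : k.+1.-tuple 'rV[F]_d |
    dotprod_chain alpha x & all (fun v => v \in E) x].

(* Main.v *)
(* The matrix [x . y = t] is the constant matrix 1/q plus a discrepancy matrix
   whose Gram matrix vanishes except on proportional pairs; its operator norm is
   therefore at most lam = 2 q^((d-1)/2) for t <> 0 and 2 q^(d/2) for t = 0.
   Restricting to E, with m = |E|/q, the number of walks of length l starting at
   a point is m^l up to an l2-error sqrt|E| ((m + lam)^l - m^l), so the number of
   walks with k edges is |E| m^k (1 + O(lam/m)), and lam/m = O(q^-eps).
   In a walk with a repeated point x_i = x_j, deleting an end point leaves a
   shorter walk, and deleting an inner x_j leaves two walks with k - 2 edges in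
   total; such walks are fewer by a factor q/|E|, respectively q^2/|E|. *)
Require Import Defs.
From HB Require Import structures.
From mathcomp Require Import all_boot all_order all_algebra.
From mathcomp Require Import all_classical all_reals all_analysis.
From mathcomp Require Import ring lra zify.

Set Implicit Arguments.
Unset Strict Implicit.
Unset Printing Implicit Defensive.

Import Order.TTheory GRing.Theory Num.Theory.
Import numFieldNormedType.Exports.

Local Open Scope classical_set_scope.
Local Open Scope ring_scope.

(** * The l2 norm over a finite set and the Cauchy-Schwarz inequality *)

Section L2.
Context {R : rcfType} {I : finType}.
Implicit Types (A : {set I}) (f g : I -> R).

Lemma cauchy_schwarz A f g :
  (\sum_(i in A) f i * g i) ^+ 2 <=
  (\sum_(i in A) f i ^+ 2) * (\sum_(i in A) g i ^+ 2).
Proof.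
rewrite -subr_ge0 -(pmulrn_lge0 _ (isT : (0 < 2)%N)).
(* Lagrange's identity. Summing over all ordered pairs counts every term twice, hence the
   doubling. *)
have -> : ((\sum_(i in A) f i ^+ 2) * (\sum_(i in A) g i ^+ 2) -
    (\sum_(i in A) f i * g i) ^+ 2) *+ 2 =
    \sum_(i in A) \sum_(j in A) (f i * g j - f j * g i) ^+ 2.
  rewrite mulr2n {1}[(\sum_(i in A) f i ^+ 2) * _]mulrC addrACA -opprD.
  rewrite expr2 !big_distrlr /= -!big_split /= -sumrN -big_split /=.
  apply: eq_bigr => i _; rewrite -!big_split -sumrN -big_split /=.
  by apply: eq_bigr => j _; ring.
by apply: sumr_ge0 => i _; apply: sumr_ge0 => j _; apply: sqr_ge0.
Qed.

Definition l2norm A f : R := Num.sqrt (\sum_(i in A) f i ^+ 2).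

Lemma l2norm_ge0 A f : 0 <= l2norm A f.
Proof. exact: sqrtr_ge0. Qed.

Lemma sqr_l2norm A f : l2norm A f ^+ 2 = \sum_(i in A) f i ^+ 2.
Proof. by rewrite sqr_sqrtr // sumr_ge0 // => i _; apply: sqr_ge0. Qed.

Lemma eq_l2norm A f g : {in A, f =1 g} -> l2norm A f = l2norm A g.
Proof. by move=> fg; congr Num.sqrt; apply: eq_bigr => i /fg ->. Qed.

Lemma l2norm_cst A (c : R) : 0 <= c ->
  l2norm A (fun=> c) = Num.sqrt #|A|%:R * c.
Proof.
move=> c0; rewrite /l2norm sumr_const -(mulr_natl (c ^+ 2)) sqrtrM ?ler0n //.
by rewrite sqrtr_sqr ger0_norm.
Qed.

Lemma l2norm_dot A f g :
  `|\sum_(i in A) f i * g i| <= l2norm A f * l2norm A g.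
Proof.
rewrite -ler_sqr ?nnegrE ?mulr_ge0 ?l2norm_ge0 //.
by rewrite real_normK ?num_real // exprMn !sqr_l2norm cauchy_schwarz.
Qed.

Lemma l2normD A f g :
  l2norm A (fun i => f i + g i) <= l2norm A f + l2norm A g.
Proof.
rewrite -ler_sqr ?nnegrE ?addr_ge0 ?l2norm_ge0 // sqrrD !sqr_l2norm.
have -> : \sum_(i in A) (f i + g i) ^+ 2 =
  \sum_(i in A) f i ^+ 2 + (\sum_(i in A) f i * g i) *+ 2 +
  \sum_(i in A) g i ^+ 2.
  by rewrite -sumrMnl -!big_split; apply: eq_bigr => i _ /=; rewrite sqrrD.
rewrite lerD2r lerD2l lerMn2r /=.
exact: le_trans (ler_norm _) (l2norm_dot _ _ _).
Qed.

Lemma norm_sum_l2norm A f :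
  `|\sum_(i in A) f i| <= Num.sqrt #|A|%:R * l2norm A f.
Proof.
have := l2norm_dot A f (fun=> 1); rewrite l2norm_cst // mulr1 mulrC.
by under eq_bigr do rewrite mulr1.
Qed.

End L2.

(** * Bilinearity of the dot product and separation of non-proportional vectors *)

Section DotProduct.
Context {F : finFieldType} {d : nat}.
Implicit Types (x y : 'rV[F]_d) (a t : F).

Lemma dotprodC x y : dotprod x y = dotprod y x.
Proof. by apply: eq_bigr => i _; rewrite mulrC. Qed.

Lemma dotprodDr x y z : dotprod x (y + z) = dotprod x y + dotprod x z.
Proof.
by rewrite -big_split; apply: eq_bigr => i _; rewrite mxE mulrDr.
Qed.

Lemma dotprodZr x a y : dotprod x (a *: y) = a * dotprod x y.
Proof.
by rewrite /dotprod mulr_sumr; apply: eq_bigr => i _; rewrite mxE mulrCA.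
Qed.

Lemma dotprodZl x a y : dotprod (a *: x) y = a * dotprod x y.
Proof. by rewrite dotprodC dotprodZr dotprodC. Qed.

Lemma dotprod0l y : dotprod 0 y = 0.
Proof. by apply: big1 => i _; rewrite mxE mul0r. Qed.

(** The columns of [cokermx x] are orthogonal to [x], and a [y] outside the span of [x] has a
    nonzero product with one of them; rescaling that column makes the product 1. *)
Lemma dotprod_separate x y : ~~ (y <= x)%MS ->
  exists2 v, dotprod x v = 0 & dotprod y v = 1.
Proof.
rewrite submxE => /matrix0Pn [i [j]]; rewrite (ord1 i) => nz.
have dE z : dotprod z (((y *m cokermx x) 0 j)^-1 *: (col j (cokermx x))^T)
    = ((y *m cokermx x) 0 j)^-1 * (z *m cokermx x) 0 j.
  rewrite dotprodZr !mxE; congr (_ * _).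
  by apply: eq_bigr => k _; rewrite !mxE.
exists (((y *m cokermx x) 0 j)^-1 *: (col j (cokermx x))^T).
  by rewrite dE mulmx_coker [X in _ * X]mxE mulr0.
by rewrite dE mulVf.
Qed.

End DotProduct.

(** * Operator norm of the discrepancy matrix *)

Section Discrepancy.
Context {R : rcfType} {F : finFieldType} {d : nat}.
Implicit Types (x y : 'rV[F]_d) (a t : F).

Local Notation q := (#|F|%:R : R).

Definition disc t x y : R := (dotprod x y == t)%:R - q^-1.

Lemma card_field_gt1 : 1 < q.
Proof. by rewrite ltr1n card_finNzRing_gt1. Qed.

Lemma card_field_gt0 : 0 < q.
Proof. exact: lt_trans card_field_gt1. Qed.

Lemma submx_rV0 x : (x <= (0 : 'rV_d))%MS = (x == 0).
Proof.
by apply/sub_rVP/eqP => [[a ->]|->]; [|exists 0]; rewrite scaler0.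
Qed.

Lemma sum_shift_eq (u t : F) : \sum_(c : F) (u + c == t)%:R = 1 :> R.
Proof.
under eq_bigr => c _.
  have -> : (u + c == t) = (c == t - u).
    by rewrite [RHS]eq_sym subr_eq eq_sym addrC.
  over.
rewrite (bigD1 (t - u)) //= eqxx big1 ?addr0 // => c /negbTE -> //.
Qed.

Lemma normr_disc_le t x y : `|disc t x y| <= (dotprod x y == t)%:R + q^-1.
Proof.
rewrite (le_trans (ler_normB _ _)) //.
by rewrite ger0_norm ?ler0n // ger0_norm // invr_ge0 ler0n.
Qed.

Lemma normr_disc_le1 t x y : `|disc t x y| <= 1.
Proof.
have q1 : q^-1 <= 1 by rewrite invf_le1 ?card_field_gt0 ?ltW ?card_field_gt1.
have q0 : 0 <= q^-1 by rewrite invr_ge0 ler0n.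
by rewrite /disc ler_norml; case: eqP => _ /=; lra.
Qed.

Definition gram t x x' : R := \sum_y disc t x y * disc t x' y.

Lemma gramC t x x' : gram t x x' = gram t x' x.
Proof. by apply: eq_bigr => y _; rewrite mulrC. Qed.

(* A shift [y -> y + c v] with [x . v = 0] and [x' . v = 1] fixes the first
   factor, while the second one averages to zero over [c]. *)
Lemma gram_eq0 t x x' : ~~ (x' <= x)%MS -> gram t x x' = 0.
Proof.
move=> /dotprod_separate [v xv x'v].
have H c : gram t x x' =
    \sum_y disc t x y * ((dotprod x' y + c == t)%:R - q^-1).
  rewrite /gram (reindex_inj (addIr (c *: v))) /=; apply: eq_bigr => y _.
  by rewrite /disc !dotprodDr !dotprodZr xv x'v mulr0 addr0 mulr1.
apply: (mulfI (lt0r_neq0 card_field_gt0)); rewrite mulr0 mulr_natl.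
rewrite -sumr_const (eq_bigr _ (fun c _ => H c)) exchange_big /= big1 // => y _.
rewrite -mulr_sumr sumrB sum_shift_eq sumr_const -[X in _ - X]mulr_natl.
rewrite mulfV ?subrr ?mulr0 //.
exact: lt0r_neq0 card_field_gt0.
Qed.

(** Translation by [c *: v] with x . v = 1 permutes the level sets of y -> x . y, so all of them
    have the same size; averaging over [c] gives that size. *)
Lemma sum_dotprod_eq t x : x != 0 ->
  \sum_y (dotprod x y == t)%:R = q ^+ d / q :> R.
Proof.
move=> x0.
have [v _ xv] : exists2 v, dotprod (0 : 'rV[F]_d) v = 0 & dotprod x v = 1.
  by apply: dotprod_separate; rewrite submx_rV0.
have H c : \sum_y (dotprod x y == t)%:R =
    \sum_y (dotprod x y + c == t)%:R :> R.
  rewrite (reindex_inj (addIr (c *: v))) /=; apply: eq_bigr => y _.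
  by rewrite dotprodDr dotprodZr xv mulr1.
have q0 := lt0r_neq0 card_field_gt0.
apply: (mulfI q0); rewrite mulrCA mulfV // mulr1 mulr_natl.
rewrite -sumr_const (eq_bigr _ (fun c _ => H c)) exchange_big /=.
under eq_bigr do rewrite sum_shift_eq.
by rewrite sumr_const cardT -cardE card_mx mul1n natrX.
Qed.

(** The excluded case x = 0, t = 0 is the one where x . y = t holds for every y, so that the sum has
    order q^d instead of q^(d-1). *)
Lemma sum_normr_disc t x : (x != 0) || (t != 0) ->
  \sum_y `|disc t x y| <= 2 * (q ^+ d / q).
Proof.
move=> xt; rewrite (le_trans (ler_sum _ (fun y _ => normr_disc_le t x y))) //.
rewrite big_split /= sumr_const card_mx mul1n -[X in _ + X]mulr_natl.
rewrite natrX mulr2n mulrDl mul1r lerD2r.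
have [x0|x0] := boolP (x == 0); last by rewrite sum_dotprod_eq.
rewrite x0 /= in xt; rewrite big1 ?divr_ge0 ?exprn_ge0 ?ler0n // => y _.
by rewrite (eqP x0) dotprod0l eq_sym (negbTE xt).
Qed.

(** The map c -> c x covers the multiples of x, but q times over when x = 0; hence only an
    inequality. *)
Lemma sum_multiples_le x (h : 'rV[F]_d -> R) : (forall y, 0 <= h y) ->
  \sum_(x' | (x' <= x)%MS) h x' <= \sum_c h (c *: x).
Proof.
move=> h0; rewrite (partition_big (fun c => c *: x) (fun x' => (x' <= x)%MS)).
  apply: ler_sum => x' /sub_rVP [a ->].
  rewrite (bigD1 a) //= lerDl; exact: sumr_ge0.
by move=> c _; apply: scalemx_sub.
Qed.

(** Up to the factor 4, this bounds the absolute row sums of the Gram matrix, and thereby the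
    squared operator norm of the discrepancy matrix. *)
Definition gram_bound t : R := if t == 0 then q ^+ d else q ^+ d / q.

Lemma gram_bound_ge0 t : 0 <= gram_bound t.
Proof.
by rewrite /gram_bound; case: ifP; rewrite ?divr_ge0 // exprn_ge0 // ler0n.
Qed.

Lemma sum_normr_gram t x : \sum_x' `|gram t x x'| <= 4 * gram_bound t.
Proof.
rewrite (bigID (fun x' => (x' <= x)%MS)) /= addrC big1 ?add0r; last first.
  by move=> x' /gram_eq0 ->; rewrite normr0.
have qd0 : 0 <= q ^+ d by rewrite exprn_ge0 // ler0n.
(* In this degenerate row the only multiple of x is 0, so a single entry survives and the trivial
   bound of 1 per term suffices. *)
have [/andP[/eqP x0 /eqP t0]|] := boolP ((x == 0) && (t == 0)).
  rewrite (big_pred1 0) => [|x']; last by rewrite x0 submx_rV0.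
  rewrite /gram_bound t0 eqxx.
  have : `|gram 0 x 0| <= q ^+ d; last by move: qd0; lra.
  rewrite (le_trans (ler_norm_sum _ _ _)) //.
  have -> : q ^+ d = \sum_(y : 'rV[F]_d) 1.
    by rewrite sumr_const card_mx mul1n natrX.
  by apply: ler_sum => y _; rewrite normrM mulr_ile1 ?normr_disc_le1.
rewrite negb_and => xt.
(* For t nonzero, c (x . y) = t has at most one solution c, so the indicators contribute at most 1
   and the q terms 1/q contribute another 1. For t = 0 every c may be a solution, which costs a
   factor q. *)
have sumL y : \sum_(x' | (x' <= x)%MS) `|disc t x' y| <=
    2 * (if t == 0 then q else 1).
  apply: (le_trans (@sum_multiples_le x (fun x' => `|disc t x' y|) _)) => //.
  have [t0|t0] := eqVneq t 0.
    apply: (@le_trans _ _ (\sum_(c : F) 1)).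
      by apply: ler_sum => c _; apply: normr_disc_le1.
    by rewrite sumr_const; have := ler0n R #|F|; lra.
  apply: (le_trans (ler_sum _ (fun c _ => normr_disc_le t (c *: x) y))).
  rewrite big_split /= sumr_const -[X in _ + X]mulr_natl mulfV; last first.
    exact: lt0r_neq0 card_field_gt0.
  rewrite mulr1 lerD2r.
  have [u0|u0] := eqVneq (dotprod x y) 0.
    rewrite big1 ?ler01 // => c _.
    by rewrite dotprodZl u0 mulr0 eq_sym (negbTE t0).
  rewrite (bigD1 (t / dotprod x y)) //= dotprodZl divfK // eqxx.
  rewrite big1 ?addr0 // => c ct; rewrite dotprodZl.
  by rewrite -[X in _ == X](divfK u0) (inj_eq (mulIf u0)) (negbTE ct).
have -> : 4 * gram_bound t =
    (2 * (q ^+ d / q)) * (2 * (if t == 0 then q else 1)).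
  have q0 := lt0r_neq0 card_field_gt0.
  by rewrite /gram_bound; case: ifP => _; field.
apply: (le_trans _ (ler_wpM2r _ (sum_normr_disc xt))); last first.
  by case: ifP; rewrite mulr_ge0 // ler0n.
rewrite mulr_suml; apply: (@le_trans _ _
  (\sum_(x' | (x' <= x)%MS) \sum_y `|disc t x y| * `|disc t x' y|)).
  apply: ler_sum => x' _; rewrite (le_trans (ler_norm_sum _ _ _)) //.
  by apply: ler_sum => y _; rewrite normrM.
rewrite exchange_big /=; apply: ler_sum => y _.
by rewrite -mulr_sumr ler_wpM2l.
Qed.

(* Schur's test applied to the Gram matrix of the discrepancy matrix. *)
Lemma sum_sqr_disc t (f : 'rV[F]_d -> R) :
  \sum_y (\sum_x disc t x y * f x) ^+ 2 <= 4 * gram_bound t * \sum_x f x ^+ 2.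
Proof.
have -> : \sum_y (\sum_x disc t x y * f x) ^+ 2 =
    \sum_x \sum_x' gram t x x' * (f x * f x').
  under eq_bigr do rewrite expr2 big_distrlr /=.
  rewrite exchange_big /=; apply: eq_bigr => x _.
  rewrite exchange_big /=; apply: eq_bigr => x' _.
  by rewrite /gram mulr_suml; apply: eq_bigr => y _; rewrite mulrACA.
(* The product f x * f x' is bounded by half the sum of the squares; by symmetry of the Gram matrix
   both halves reduce to the same row-sum estimate. *)
apply: (@le_trans _ _ (\sum_x \sum_x'
  (`|gram t x x'| * f x ^+ 2 / 2 + `|gram t x x'| * f x' ^+ 2 / 2))).
  apply: ler_sum => x _; apply: ler_sum => x' _.
  rewrite (le_trans (ler_norm _)) // normrM -mulrDl -mulrDr -mulrA.
  rewrite ler_wpM2l // normrM -(real_normK (num_real (f x))).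
  rewrite -(real_normK (num_real (f x'))).
  by have := sqr_ge0 (`|f x| - `|f x'|); lra.
have S (g : 'rV[F]_d -> R) : (forall x, 0 <= g x) ->
    \sum_x \sum_x' `|gram t x x'| * g x <= 4 * gram_bound t * \sum_x g x.
  move=> g0; rewrite mulr_sumr; apply: ler_sum => x _.
  by rewrite -mulr_suml ler_wpM2r // sum_normr_gram.
under eq_bigr do rewrite big_split /= -!mulr_suml.
rewrite big_split /= -!mulr_suml [X in _ + X / 2]exchange_big /=.
under [X in _ + X / 2]eq_bigr do under eq_bigr do rewrite gramC.
under [X in X / 2 + _]eq_bigr do rewrite mulr_suml.
have := S (fun x => f x ^+ 2) (fun x => sqr_ge0 (f x)) => /=.
by set X := \sum_x _; lra.
Qed.

Lemma l2norm_disc_le t (E : {set 'rV[F]_d}) (f : 'rV[F]_d -> R) :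
  l2norm E (fun x => \sum_(y in E) disc t x y * f y) <=
  2 * Num.sqrt (gram_bound t) * l2norm E f.
Proof.
rewrite -ler_sqr ?nnegrE ?mulr_ge0 ?l2norm_ge0 ?sqrtr_ge0 //.
rewrite !exprMn !sqr_l2norm sqr_sqrtr ?gram_bound_ge0 // -natrX.
(* Extension by zero: restricting rows and columns to [E] cannot increase the operator norm. *)
pose f' y := if y \in E then f y else 0.
have -> : \sum_(y in E) f y ^+ 2 = \sum_y f' y ^+ 2.
  rewrite big_mkcond; apply: eq_bigr => y _.
  by rewrite /f'; case: ifP; rewrite // expr0n.
apply: le_trans (sum_sqr_disc t f'); rewrite big_mkcond; apply: ler_sum => x _.
case: ifP => _; last exact: sqr_ge0.
rewrite le_eqVlt; apply/orP; left; apply/eqP; congr (_ ^+ 2).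
rewrite big_mkcond; apply: eq_bigr => y _.
by rewrite /f' /disc dotprodC; case: ifP; rewrite // mulr0.
Qed.

End Discrepancy.

(** * Walks with prescribed dot products, and deletion of a repeated point *)

Section Walks.
Context {F : finFieldType} {d : nat} (E : {set 'rV[F]_d}).
Implicit Types (x y : 'rV[F]_d) (a : F) (s : seq F) (p : seq 'rV[F]_d).

(** Points may repeat. Plain sequences, rather than tuples, let walks be cut by [take] and [drop]
    without casts; the size test keeps all indices in range, so the default value 0 is never
    read. *)
Definition walk s p :=
  [&& size p == (size s).+1, all (fun x => x \in E) p &
      all (fun i => dotprod p`_i p`_i.+1 == s`_i) (iota 0 (size s))].

Lemma walkP s p : reflect
  [/\ size p = (size s).+1, (forall i, (i <= size s)%N -> p`_i \in E) &
      (forall i, (i < size s)%N -> dotprod p`_i p`_i.+1 = s`_i)]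
  (walk s p).
Proof.
apply: (iffP and3P) => [[/eqP sp /all_nthP pE /allP sE]|[sp pE sE]]; split=> //.
- by move=> i si; apply: pE; rewrite sp.
- by move=> i si; apply/eqP/sE; rewrite mem_iota.
- by apply/eqP.
- by apply/(all_nthP 0) => i; rewrite sp => /pE.
- by apply/allP => i; rewrite mem_iota => /sE ->.
Qed.

Lemma walk_nil p : walk [::] p = (size p == 1)%N && (p`_0 \in E).
Proof. by case: p => [|x []] //=; rewrite /walk /= !andbT. Qed.

Lemma walk_cons a s x p :
  walk (a :: s) (x :: p) = [&& x \in E, dotprod x p`_0 == a & walk s p].
Proof.
rewrite /walk /= eqSS (iotaDl 1 0) all_map /=.
by rewrite -!andbA; do !bool_congr.
Qed.

Lemma walk_size s p : walk s p -> size p = (size s).+1.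
Proof. by case/walkP. Qed.

Lemma walk_drop j s p : (j <= size s)%N -> walk s p ->
  walk (drop j s) (drop j p).
Proof.
move=> js /walkP[sp pE sE]; apply/walkP; rewrite !size_drop sp subSn //.
split=> // i si; rewrite !nth_drop ?addnS; first by apply: pE; lia.
by apply: sE; lia.
Qed.

(** A walk with j edges has j + 1 points, whence the shift between the two arguments of [take]. *)
Lemma walk_take j s p : (j <= size s)%N -> walk s p ->
  walk (take j s) (take j.+1 p).
Proof.
move=> js /walkP[sp pE sE]; apply/walkP.
rewrite !size_take_min sp; split=> [|i si|i si]; first by lia.
  by rewrite nth_take; [apply: pE|]; lia.
by rewrite !nth_take; [apply: sE| | |]; lia.
Qed.

(** Only the points after [x] are listed, and [x] itself is not tested for membership in [E]. The
    recursion on the first edge mirrors one multiplication by the adjacency matrix. *)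
Fixpoint walks_from s x : seq (seq 'rV[F]_d) :=
  if s is a :: s' then
    [seq y :: p | y <- [seq y <- enum E | dotprod x y == a],
                  p <- walks_from s' y]
  else [:: [::]].

Definition walks s : seq (seq 'rV[F]_d) :=
  [seq x :: p | x <- enum E, p <- walks_from s x].

Lemma allpairs_cons_uniq (l : seq 'rV[F]_d) (w : 'rV[F]_d -> seq (seq 'rV[F]_d)) :
  uniq l -> (forall x, uniq (w x)) -> uniq [seq x :: p | x <- l, p <- w x].
Proof.
move=> ul uw; apply: allpairs_uniq_dep => // -[x p] [y p'] _ _ /=.
by move=> [-> ->].
Qed.

Lemma walks_from_uniq s x : uniq (walks_from s x).
Proof.
elim: s x => [//|a s IH] x /=.
by apply: allpairs_cons_uniq => //; rewrite filter_uniq // enum_uniq.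
Qed.

Lemma walks_uniq s : uniq (walks s).
Proof.
apply: allpairs_cons_uniq; [exact: enum_uniq|exact: walks_from_uniq].
Qed.

Lemma mem_walks_from s x p : x \in E -> (p \in walks_from s x) = walk s (x :: p).
Proof.
elim: s x p => [|a s IH] x p xE /=.
  by rewrite inE walk_nil /= xE andbT eqSS size_eq0.
rewrite walk_cons xE /=.
apply/allpairsPdep/andP => [[y [p' [+ + ->]]]|[xp]].
  by rewrite mem_filter mem_enum => /andP[xy yE]; rewrite IH.
case: p xp => [_|y p' /= xy W]; first by move/walk_size.
have /walkP[_ /(_ 0%N isT) /= yE _] := W.
by exists y, p'; rewrite mem_filter mem_enum xy yE IH.
Qed.

Lemma mem_walks s p : (p \in walks s) = walk s p.
Proof.
apply/allpairsPdep/idP => [[x [p' [+ + ->]]]|].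
  by rewrite mem_enum => xE; rewrite mem_walks_from.
case: p => [/walk_size//|x p W].
have /walkP[_ /(_ 0%N isT) /= xE _] := W.
by exists x, p; rewrite mem_enum mem_walks_from.
Qed.

Lemma size_walks_from a s x : size (walks_from (a :: s) x) =
  (\sum_(y in E) (dotprod x y == a) * size (walks_from s y))%N.
Proof.
rewrite /= size_allpairs_dep sumnE big_map big_filter big_enum_cond /=.
by rewrite big_mkcondr; apply: eq_bigr => y _; case: eqP; rewrite ?mul1n.
Qed.

Lemma size_walks s : size (walks s) = (\sum_(x in E) size (walks_from s x))%N.
Proof. by rewrite size_allpairs_dep sumnE big_map big_enum. Qed.

Lemma count_inj_leq (T U : eqType) (P : pred T) (f : T -> U)
    (l : seq T) (l' : seq U) :
  uniq l -> {in [seq u <- l | P u] &, injective f} ->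
  (forall u, u \in l -> P u -> f u \in l') -> (count P l <= size l')%N.
Proof.
move=> ul finj fl; rewrite -size_filter -(size_map f).
apply: uniq_leq_size; first by rewrite map_inj_in_uniq // filter_uniq.
by move=> _ /mapP[u + ->]; rewrite mem_filter => /andP[Pu /fl]; apply.
Qed.

Definition repeats i j p := p`_i == p`_j.

(* A repetition [x_i = x_j] lets one recover [x_j] from the remaining points. *)
Lemma eq_from_take_drop i j p p' : i != j -> size p = size p' ->
  p`_i = p`_j -> p'`_i = p'`_j ->
  take j p = take j p' -> drop j.+1 p = drop j.+1 p' -> p = p'.
Proof.
move=> ij sp pij p'ij tp dp.
have E1 l : l != j -> p`_l = p'`_l.
  rewrite neq_ltn => /orP[lj|jl].
    by rewrite -(nth_take 0 lj) tp nth_take.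
  by rewrite -(subnKC jl) -!nth_drop dp.
apply: (eq_from_nth (x0 := 0)) => // l _.
by have [->|/E1//] := eqVneq l j; rewrite -pij -p'ij E1.
Qed.

(** Deleting the first point loses nothing, since it reappears at position j. *)
Lemma count_repeat_leq_behead s j : (0 < j)%N -> (0 < size s)%N ->
  (count (repeats 0 j) (walks s) <= size (walks (behead s)))%N.
Proof.
move=> j0 s0; apply: (@count_inj_leq _ _ _ (drop 1)) => [||p pw _].
- exact: walks_uniq.
- move=> p p'; rewrite !mem_filter !mem_walks.
  move=> /andP[/eqP e /walk_size sp] /andP[/eqP e' /walk_size sp'] dp.
  apply: (@eq_from_take_drop j 0) => //; rewrite ?take0 ?sp ?sp' //.
  by rewrite -lt0n.
- by rewrite mem_walks -drop1 walk_drop // -mem_walks.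
Qed.

(** Here x_j is the last point. The j points before it form a walk with j - 1 edges and still
    contain its copy x_i. *)
Lemma count_repeat_leq_take s i j : (i < j)%N -> j = size s ->
  (count (repeats i j) (walks s) <= size (walks (take j.-1 s)))%N.
Proof.
move=> ij js; apply: (@count_inj_leq _ _ _ (take j)) => [||p pw _].
- exact: walks_uniq.
- move=> p p'; rewrite !mem_filter !mem_walks.
  move=> /andP[/eqP e /walk_size sp] /andP[/eqP e' /walk_size sp'] tp.
  apply: (@eq_from_take_drop i j) => //; rewrite ?sp ?sp' //.
    by rewrite neq_ltn ij.
  by rewrite !drop_oversize // ?sp ?sp' js.
- have := @walk_take j.-1 s p; rewrite -mem_walks pw prednK; last by lia.
  by rewrite mem_walks; apply=> //; lia.
Qed.

(** Deleting x_j destroys both edges at x_j: the pieces before and after it have j - 1 and [size s]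
    - j - 1 edges. The first piece contains x_i, so the pair of pieces determines the walk. *)
Lemma count_repeat_leq_mul s i j : (i < j)%N -> (j < size s)%N ->
  (count (repeats i j) (walks s) <=
   size (walks (take j.-1 s)) * size (walks (drop j.+1 s)))%N.
Proof.
move=> ij js; rewrite -(size_allpairs pair).
apply: (@count_inj_leq _ _ _ (fun p => (take j p, drop j.+1 p))) => [||p pw _].
- exact: walks_uniq.
- move=> p p'; rewrite !mem_filter !mem_walks.
  move=> /andP[/eqP e /walk_size sp] /andP[/eqP e' /walk_size sp'] [tp dp].
  apply: (@eq_from_take_drop i j) => //; rewrite ?sp ?sp' //.
  by rewrite neq_ltn ij.
- rewrite mem_walks in pw; apply: allpairs_f; rewrite mem_walks.
    have := @walk_take j.-1 s p; rewrite prednK; last by lia.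
    by apply=> //; lia.
  exact: walk_drop.
Qed.

Lemma count_not_uniq_leq s :
  (count (fun p => ~~ uniq p) (walks s) <=
   \sum_(ij : 'I_(size s).+1 * 'I_(size s).+1 | (ij.1 < ij.2)%N)
     count (repeats ij.1 ij.2) (walks s))%N.
Proof.
under eq_bigr do rewrite -sum1_count big_mkcond.
rewrite -sum1_count big_mkcond exchange_big /=.
rewrite big_seq [leqRHS]big_seq; apply: leq_sum => p.
rewrite mem_walks => /walk_size sp; case: ifP => // /(uniqPn 0).
move=> [i [j [ij jp e]]].
have js : (j < (size s).+1)%N by rewrite -sp.
have is_ : (i < (size s).+1)%N by apply: ltn_trans js.
by rewrite (bigD1 (Ordinal is_, Ordinal js)) //= /repeats e eqxx.
Qed.

Lemma card_chains_in k (alpha : k.-tuple F) :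
  (#|chains_in alpha E| + count (fun p => ~~ uniq p) (walks alpha))%N =
  size (walks alpha).
Proof.
rewrite -(count_predC uniq (walks alpha)); congr (_ + _)%N.
rewrite cardE -(size_map val) -size_filter; apply: perm_size.
apply: uniq_perm; [|by rewrite filter_uniq // walks_uniq|move=> p].
  by rewrite map_inj_uniq ?enum_uniq //; apply: val_inj.
rewrite mem_filter mem_walks; apply/mapP/andP => [[x + ->]|[up W]].
  rewrite mem_enum inE => /andP[/andP[ux /forallP H] xE]; split=> //.
  apply/and3P; split=> //; rewrite ?size_tuple //.
  apply/allP => i; rewrite mem_iota /= => ik.
  by have := H (Ordinal ik); rewrite /= (tnth_nth 0).
have sp := walk_size W; rewrite size_tuple in sp.
exists (tcast sp (in_tuple p)); last by rewrite /= val_tcast.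
have /and3P[_ pE /allP pa] := W.
rewrite mem_enum inE /dotprod_chain val_tcast up /= pE andbT.
apply/forallP => i; rewrite (tnth_nth 0); apply: pa.
by rewrite mem_iota size_tuple /=.
Qed.

End Walks.

(** * Counting walks, and bounding those with a repeated point *)

Section WalkCount.
Context {R : rcfType} {F : finFieldType} {d : nat} (E : {set 'rV[F]_d}).
Implicit Types (x y : 'rV[F]_d) (s : seq F).

Local Notation n := (#|E|%:R : R).
Local Notation m := (n / #|F|%:R).

Definition spectral_bound (lam : R) s := forall a, a \in s ->
  2 * Num.sqrt (gram_bound (d := d) a) <= lam.

(** Induction on the length. The constant part 1/q of the adjacency matrix multiplies the old error
    by at most m, while the discrepancy part acts on the full count, whose norm is at most sqrt n (m
    + lam)^l. *)
Lemma walks_from_l2norm (lam : R) s : 0 <= lam -> spectral_bound lam s ->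
  l2norm E (fun x => (size (walks_from E s x))%:R - m ^+ size s) <=
  Num.sqrt n * ((m + lam) ^+ size s - m ^+ size s).
Proof.
move=> lam0; have m0 : 0 <= m by rewrite divr_ge0 ?ler0n.
elim: s => [_|a s IH sb].
  by rewrite !expr0 subrr mulr0 l2norm_cst // mulr0.
have {}IH := IH (fun b bs => sb b (mem_behead (s := a :: s) bs)).
have ha : 2 * Num.sqrt (gram_bound (d := d) a) <= lam.
  by apply: sb; rewrite mem_head.
set l := size s in IH *; set w := fun x => (size (walks_from E s x))%:R : R.
set r := fun x => w x - m ^+ l; rewrite -/(l2norm E r) in IH.
rewrite (@eq_l2norm _ _ _ _ (fun x =>
    #|F|%:R^-1 * (\sum_(y in E) r y) + \sum_(y in E) disc a x y * w y)); last first.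
  move=> x _; rewrite size_walks_from natr_sum /= exprS sumrB sumr_const.
  rewrite mulrBr addrAC -(mulr_natl (_ ^+ l)) [X in _ = _ - X]mulrA.
  rewrite [_^-1 * n]mulrC; congr (_ - _).
  rewrite mulr_sumr -big_split; apply: eq_bigr => y _ /=.
  by rewrite natrM /disc mulrBl addrC subrK.
apply: (le_trans (l2normD _ _ _)).
have wr : l2norm E w <= Num.sqrt n * (m + lam) ^+ l.
  rewrite (@eq_l2norm _ _ _ _ (fun x => r x + m ^+ l)) => [|x _]; last first.
    by rewrite /r subrK.
  apply: (le_trans (l2normD _ _ _)); rewrite l2norm_cst ?exprn_ge0 //.
  by move: IH; rewrite mulrBr; lra.
have H1 : l2norm E (fun=> #|F|%:R^-1 * (\sum_(y in E) r y)) <=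
    m * l2norm E r.
  set c := _ * _.
  have -> : l2norm E (fun=> c) = l2norm E (fun=> `|c|).
    by rewrite /l2norm; under [in RHS]eq_bigr do rewrite real_normK ?num_real //.
  rewrite l2norm_cst // /c normrM ger0_norm ?invr_ge0 ?ler0n //.
  rewrite mulrCA [n / _]mulrC -[leRHS]mulrA ler_wpM2l ?invr_ge0 //.
  apply: le_trans (ler_wpM2l (sqrtr_ge0 _) (norm_sum_l2norm _ _)) _.
  by rewrite mulrA -expr2 sqr_sqrtr ?ler0n.
have H2 : l2norm E (fun x => \sum_(y in E) disc a x y * w y) <=
    lam * l2norm E w.
  apply: (le_trans (l2norm_disc_le _ _ _)).
  by rewrite ler_wpM2r ?l2norm_ge0.
apply: (le_trans (lerD H1 H2)).
apply: (le_trans (lerD (ler_wpM2l m0 IH) (ler_wpM2l lam0 wr))).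
(* The recursion closes because m ((m + lam)^l - m^l) + lam (m + lam)^l = (m + lam)^(l+1) -
   m^(l+1). *)
by rewrite !exprS; lra.
Qed.

Lemma size_walks_approx (lam : R) s : 0 <= lam -> spectral_bound lam s ->
  `|(size (walks E s))%:R - n * m ^+ size s| <=
  n * ((m + lam) ^+ size s - m ^+ size s).
Proof.
move=> lam0 sb; have := norm_sum_l2norm E
  (fun x => (size (walks_from E s x))%:R - m ^+ size s).
rewrite sumrB sumr_const -(mulr_natl (m ^+ _)) size_walks natr_sum.
move/le_trans; apply.
have := ler_wpM2l (sqrtr_ge0 n) (walks_from_l2norm lam0 sb).
by rewrite mulrA -expr2 sqr_sqrtr ?ler0n.
Qed.

Lemma size_walks_le (lam : R) s : 0 <= lam -> spectral_bound lam s ->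
  (size (walks E s))%:R <= n * (m + lam) ^+ size s.
Proof.
move=> lam0 sb; have := le_trans (ler_norm _) (size_walks_approx lam0 sb).
by rewrite mulrBr; lra.
Qed.

Lemma spectral_boundS lam s s' : {subset s' <= s} ->
  spectral_bound lam s -> spectral_bound lam s'.
Proof. by move=> ss' sb a /ss' /sb. Qed.

Context (lam z : R) (k : nat) (alpha : k.-tuple F).
Hypotheses (k2 : (2 <= k)%N) (n0 : 0 < n) (lam0 : 0 <= lam)
  (sb : spectral_bound lam alpha) (z0 : 0 <= z) (lamz : lam <= z * m).

Local Notation main := (n * m ^+ k).

Let m0 : 0 < m.
Proof. by rewrite divr_gt0 // ltr0n; apply/card_gt0P; exists 0. Qed.

Let expr_mlam l : (m + lam) ^+ l <= m ^+ l * (1 + z) ^+ l.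
Proof.
have zm0 : 0 <= m * (1 + z) by rewrite mulr_ge0 ?addr_ge0 ?(ltW m0).
rewrite -exprMn lerXn2r ?nnegrE //; first exact: addr_ge0 (ltW m0) lam0.
by move: lamz; rewrite mulrDr mulr1 lerD2l mulrC.
Qed.

Lemma size_walks_main :
  `|(size (walks E alpha))%:R - main| <= main * ((1 + z) ^+ k - 1).
Proof.
have := size_walks_approx lam0 sb; rewrite size_tuple => /le_trans; apply.
have := ler_wpM2l (ltW n0) (expr_mlam k); lra.
Qed.

(** The two assumptions pay for the two kinds of deletion: an end point costs a factor 1/m, an inner
    point a factor n/m^2, and each is at most z. Since x_0 is deleted whenever i = 0, an inner
    deletion has 0 < i < j < k and occurs only for k at least 3. The factor (k + 1)^2 bounds the
    number of pairs (i, j). *)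
Lemma count_not_uniq_main : 1 <= z * m -> ((3 <= k)%N -> n <= z * m ^+ 2) ->
  (count (fun p => ~~ uniq p) (walks E alpha))%:R <=
  k.+1%:R ^+ 2 * (main * ((1 + z) ^+ k * z)).
Proof.
move=> zm znm.
have z1 : 1 <= 1 + z by rewrite lerDl.
have z10 : 0 <= 1 + z by apply: le_trans z1.
have short s : {subset s <= alpha} -> size s = k.-1 ->
    (size (walks E s))%:R <= main * ((1 + z) ^+ k * z).
  move=> ss ssz; apply: (le_trans (size_walks_le lam0 (spectral_boundS ss sb))).
  rewrite ssz -mulrA ler_wpM2l ?(ltW n0) //; apply: (le_trans (expr_mlam _)).
  have -> : k = k.-1.+1 by lia.
  set l := k.-1; rewrite /= exprSr -mulrA ler_wpM2l ?exprn_ge0 ?(ltW m0) //.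
  have -> : m * ((1 + z) ^+ l.+1 * z) = (1 + z) ^+ l * ((1 + z) * (z * m)).
    by rewrite exprSr mulrC -!mulrA.
  by rewrite ler_peMr ?exprn_ge0 // mulr_ege1.
have pair_le i j : (i < j <= k)%N ->
    (count (repeats i j) (walks E alpha))%:R <= main * ((1 + z) ^+ k * z).
  move=> /andP[ij jk]; have [i0|i0] := eqVneq i 0%N.
    rewrite {}i0 in ij *.
    apply: (@le_trans _ _ (size (walks E (behead alpha)))%:R).
      by rewrite ler_nat count_repeat_leq_behead // size_tuple; lia.
    by apply: short; [exact: mem_behead|rewrite size_behead size_tuple].
  have [jk'|jk'] := eqVneq j k.
    apply: (@le_trans _ _ (size (walks E (take j.-1 alpha)))%:R).
      by rewrite ler_nat (@count_repeat_leq_take _ _ _ _ i) // size_tuple.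
    apply: short; first by move=> a /mem_take.
    by rewrite size_take_min size_tuple; lia.
  have {jk'}jk : (j < k)%N by rewrite ltn_neqAle jk'.
  apply: (@le_trans _ _ (size (walks E (take j.-1 alpha)) *
                         size (walks E (drop j.+1 alpha)))%:R).
    by rewrite ler_nat count_repeat_leq_mul // size_tuple.
  rewrite natrM; apply: (@le_trans _ _ ((n * (m + lam) ^+ j.-1) *
                                        (n * (m + lam) ^+ (k - j.+1)))).
    apply: ler_pM; rewrite ?ler0n //.
      have /(size_walks_le lam0) : spectral_bound lam (take j.-1 alpha).
        by apply: spectral_boundS sb => a /mem_take.
      by rewrite size_take_min size_tuple (minn_idPl _) //; lia.
    have /(size_walks_le lam0) : spectral_bound lam (drop j.+1 alpha).
      by apply: spectral_boundS sb => a /mem_drop.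
    by rewrite size_drop size_tuple.
  rewrite mulrACA -exprD -mulrA -[leRHS]mulrA ler_wpM2l ?(ltW n0) //.
  have -> : k = (j.-1 + (k - j.+1)).+2 by lia.
  have : n <= z * m ^+ 2 by apply: znm; lia.
  have -> : (j.-1 + ((j.-1 + (k - j.+1)).+2 - j.+1) = j.-1 + (k - j.+1))%N by lia.
  set l := (j.-1 + _)%N => nz.
  (* With l = k - 2 edges left in two pieces there is a surplus factor n, which is exchanged for z
     m^2. *)
  apply: (@le_trans _ _ ((z * m ^+ 2) * (m ^+ l * (1 + z) ^+ l.+2))).
    apply: ler_pM => //; rewrite ?(ltW n0) ?exprn_ge0 ?addr_ge0 ?(ltW m0) //.
    apply: (le_trans (expr_mlam _)); rewrite ler_wpM2l ?exprn_ge0 ?(ltW m0) //.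
    by rewrite ler_weXn2l //; lia.
  by rewrite -(addn2 l) [m ^+ (l + 2)]exprD; lra.
apply: (@le_trans _ _ (\sum_(ij : 'I_k.+1 * 'I_k.+1)
    main * ((1 + z) ^+ k * z))).
  have := count_not_uniq_leq E alpha; rewrite -(ler_nat R) natr_sum.
  rewrite size_tuple => /le_trans; apply.
  rewrite big_mkcond; apply: ler_sum => -[i j] _ /=; case: ifP => [ij|_].
    by apply: pair_le; rewrite ij -ltnS ltn_ord.
  by rewrite !mulr_ge0 ?exprn_ge0 ?(ltW n0) ?(ltW m0).
by rewrite sumr_const card_prod card_ord -[leLHS]mulr_natl natrM expr2.
Qed.

End WalkCount.

(** * From walks to chains, with an explicit relative error *)

Section ChainCount.
Context {R : rcfType} {F : finFieldType} {d : nat} (E : {set 'rV[F]_d}).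

Local Notation q := (#|F|%:R : R).
Local Notation n := (#|E|%:R : R).

(** The first summand is the relative error of the walk count, the second the relative share of
    walks with a repeated point. *)
Definition chain_error (k : nat) (z : R) : R :=
  ((1 + z) ^+ k - 1) + k.+1%:R ^+ 2 * ((1 + z) ^+ k * z).

(* [D] stands for [d] or, when no prescribed product is zero, for [d - 1]. *)
Lemma chains_in_approx (D k : nat) (alpha : k.-tuple F) (z : R) :
  (2 <= k)%N -> (d <= D.+1)%N -> 0 < z ->
  spectral_bound (d := d) (2 * Num.sqrt q ^+ D) alpha ->
  2 * Num.sqrt q ^+ (D + k) <= z * n ->
  exists t : R, `|t| <= chain_error k z /\
    #|chains_in alpha E|%:R = (1 + t) * (n ^+ k.+1 / q ^+ k).
Proof.
move=> k2 dD z0 sb zn.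
have q1 : 1 < q := card_field_gt1.
have q0 : 0 < q := card_field_gt0.
set r := Num.sqrt q in sb zn.
have r2 : r ^+ 2 = q by rewrite sqr_sqrtr ?ltW.
have r1 : 1 <= r by rewrite -sqrtr1 ler_sqrt ltW.
have r0 : 0 < r by apply: lt_le_trans r1.
have n0 : 0 < n.
  by rewrite -(pmulr_rgt0 _ z0); apply: lt_le_trans zn; rewrite mulr_gt0 ?exprn_gt0.
have -> : n ^+ k.+1 / q ^+ k = n * (n / q) ^+ k.
  by rewrite exprS -mulrA expr_div_n.
have m0 : 0 < n / q by rewrite divr_gt0.
have lam0 : 0 <= 2 * r ^+ D by rewrite mulr_ge0 // exprn_ge0 // ltW.
(* Since q = r^2, this amounts to 2 r^(D+2) <= z n, which follows from the size assumption as k is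
   at least 2. *)
have lamz : 2 * r ^+ D <= z * (n / q).
  rewrite mulrA ler_pdivlMr //; apply: le_trans zn.
  by rewrite -mulrA -r2 -exprD ler_wpM2l // ler_weXn2l // leq_add2l.
have zm : 1 <= z * (n / q).
  by apply: le_trans lamz; have := exprn_ege1 D r1; lra.
have main0 : 0 < n * (n / q) ^+ k by rewrite mulr_gt0 // exprn_gt0.
have W := size_walks_main n0 lam0 sb (ltW z0) lamz.
have NB : #|chains_in alpha E|%:R +
    (count (fun p => ~~ uniq p) (walks E alpha))%:R =
    (size (walks E alpha))%:R :> R by rewrite -natrD card_chains_in.
set main := n * _ in main0 W *.
set N := #|chains_in alpha E|%:R in NB *.
exists (N / main - 1); split; last by rewrite addrC subrK divfK // gt_eqF.
have -> : N / main - 1 = (N - main) / main.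
  by rewrite mulrBl divff // gt_eqF.
rewrite normrM normfV (gtr0_norm main0) ler_pdivrMr // mulrC.
have N0 : 0 <= N by rewrite ler0n.
have z1 : 1 + z <= (1 + z) ^+ k.
  by rewrite ler_eXnr ?lerDl ?(ltW z0) // ltnW.
have zk0 : 0 <= (1 + z) ^+ k by apply: le_trans z1; lra.
have [z_le1|z_gt1] := leP z 1; last first.
  (* The error term exceeds 1, so that [0 <= N <= size (walks E alpha)] suffices. *)
  apply: (@le_trans _ _ (main * ((1 + z) ^+ k - 1))); last first.
    rewrite ler_wpM2l ?(ltW main0) // lerDl mulr_ge0 ?exprn_ge0 //.
    by rewrite mulr_ge0 // ltW.
  have : main * 1 <= main * ((1 + z) ^+ k - 1).
    by rewrite ler_wpM2l ?(ltW main0) //; lra.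
  rewrite mulr1; move: W NB.
  have := ler0n R (count (fun p => ~~ uniq p) (walks E alpha)).
  by rewrite !ler_norml; lra.
have B : (count (fun p => ~~ uniq p) (walks E alpha))%:R <=
  k.+1%:R ^+ 2 * (main * ((1 + z) ^+ k * z)).
  apply: (count_not_uniq_main k2 n0 lam0 sb (ltW z0) lamz zm) => k3.
  (* Otherwise [E] would have more than [q ^ d] points. *)
  have kD : (k < D.+2)%N.
    rewrite ltnNge; apply/negP => Dk.
    have : n <= r ^+ (D + k).
      apply: (@le_trans _ _ (r ^+ (D.+1 * 2))); last first.
        by rewrite ler_weXn2l // muln2 -addnn addSnnS leq_add2l.
      rewrite mulnC exprM r2 -natrX ler_nat.
      apply: (@leq_trans (#|F| ^ d)%N); last first.
        by rewrite leq_pexp2l // -(ltr_nat R).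
      by have := max_card (mem E); rewrite card_mx mul1n.
    have := ler_piMl (ltW n0) z_le1.
    have := exprn_gt0 (D + k) r0; lra.
  (* It remains to see q^2 <= z n, that is r^4 <= z n; the bounds 3 <= k < D + 2 give D + k >= 4. *)
  have -> : z * (n / q) ^+ 2 = n * ((z * n) / q ^+ 2).
    by rewrite expr_div_n; ring.
  rewrite ler_peMr ?(ltW n0) // ler_pdivlMr ?exprn_gt0 // mul1r.
  apply: le_trans zn; rewrite -r2 -exprM.
  apply: (@le_trans _ _ (r ^+ (D + k))); last first.
    by have := exprn_gt0 (D + k) r0; lra.
  have D2 : (1 < D)%N by rewrite -ltnS (leq_trans k3).
  by rewrite ler_weXn2l // (@leq_add 1 3) // ltnW.
have -> : main * chain_error k z =
  main * ((1 + z) ^+ k - 1) + k.+1%:R ^+ 2 * (main * ((1 + z) ^+ k * z)).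
  by rewrite /chain_error; ring.
move: W B NB; have := ler0n R (count (fun p => ~~ uniq p) (walks E alpha)).
by rewrite !ler_norml; lra.
Qed.

Lemma spectral_bound_any (s : seq F) :
  spectral_bound (d := d) (2 * Num.sqrt q ^+ d) s.
Proof.
move=> a _; rewrite ler_wpM2l //.
have q0 : 0 < q := card_field_gt0.
have -> : Num.sqrt q ^+ d = Num.sqrt (q ^+ d).
  by rewrite -[in RHS](sqr_sqrtr (ltW q0)) exprAC sqrtr_sqr ger0_norm
    ?exprn_ge0 ?sqrtr_ge0.
rewrite ler_sqrt /gram_bound; last by rewrite exprn_ge0 // ltW.
case: ifP => // _; rewrite ler_pdivrMr // ler_peMr ?exprn_ge0 ?(ltW q0) //.
exact: ltW card_field_gt1.
Qed.

Lemma spectral_bound_nonzero (s : seq F) : (0 < d)%N -> 0 \notin s ->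
  spectral_bound (d := d) (2 * Num.sqrt q ^+ d.-1) s.
Proof.
move=> d0 s0 a sa; rewrite ler_wpM2l //.
have q0 : 0 < q := card_field_gt0.
have /negbTE a0 : a != 0 by apply: contraNneq s0 => <-.
rewrite /gram_bound a0 -{1}(prednK d0) exprSr mulfK ?gt_eqF //.
by rewrite -[in leLHS](sqr_sqrtr (ltW q0)) exprAC sqrtr_sqr ger0_norm
  ?exprn_ge0 ?sqrtr_ge0.
Qed.

End ChainCount.

(** * Limits as q tends to infinity, and the asymptotic formula *)

Lemma cvg_powRN (R : realType) (e : R) : 0 < e ->
  (q%:R : R) `^ (- e) @[q --> \oo] --> (0 : R).
Proof.
move=> e0; apply/cvgr0Pnorm_lt => eta eta0.
near=> q.
(* This threshold solves q^(-e) = eta. *)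
have Aq : eta `^ (- e^-1) < q%:R by near: q; exact: nbhs_infty_gtr.
rewrite ger0_norm ?powR_ge0 // powRN invf_plt ?posrE //; last first.
  by rewrite powR_gt0 //; apply: le_lt_trans Aq; apply: powR_ge0.
have := gt0_ltr_powR e0 (powR_ge0 _ _) (ler0n R q) Aq.
by rewrite -powRrM mulNr mulVf ?gt_eqF // powR_inv1 // ltW.
Unshelve. all: by end_near.
Qed.

Lemma cvg_chain_error (R : realType) (k : nat) (z : nat -> R) :
  z q @[q --> \oo] --> (0 : R) ->
  chain_error k (z q) @[q --> \oo] --> (0 : R).
Proof.
move=> z0.
have z1 : (1 + z q) ^+ k @[q --> \oo] --> (1 : R).
  have z1 : 1 + z q @[q --> \oo] --> (1 : R).
    by rewrite -[X in _ --> X](addr0 (1 : R)); apply: cvgD => //; apply: cvg_cst.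
  have := continuous_cvg _ (@exprn_continuous R k 1) z1.
  by rewrite expr1n; apply.
rewrite -[X in _ --> X]addr0; apply: cvgD.
  by rewrite -(subrr (1 : R)); apply: cvgB => //; apply: cvg_cst.
rewrite -(mulr0 (k.+1%:R ^+ 2)); apply: cvgM; first exact: cvg_cst.
by rewrite -(mulr0 (1 : R)); apply: cvgM.
Qed.

Theorem theorem1p4 (R : realType) (d k : nat) (eps C : R)
    (hd : (1 <= d)%N) (hk : (2 <= k)%N) (heps : 0 < eps) (hC : 0 < C) :
  exists o : nat -> R, o q @[q --> \oo] --> (0 : R) /\
    forall (p n : nat) (F : finFieldType) (E : {set 'rV[F]_d})
           (alpha : k.-tuple F),
      prime p -> odd p -> #|F| = (p ^ n)%N ->
      let q : R := #|F|%:R in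
      let cardE : R := #|E|%:R in
      (C * q `^ eps * q `^ ((d%:R + k%:R) / 2) <= cardE \/
       (forall j : 'I_k, tnth alpha j != 0) /\
       C * q `^ eps * q `^ ((d%:R + k%:R - 1) / 2) <= cardE) ->
      exists t : R, `|t| <= o #|F| /\
        #|chains_in alpha E|%:R = (1 + t) * (cardE ^+ k.+1 / q ^+ k).
Proof.
(* The parameter z = (2 / C) q^(-eps) is chosen so that C q^eps X <= |E| becomes 2 X <= z |E|, with
   X = q^((D+k)/2). *)
exists (fun q => chain_error k (2 / C * q%:R `^ (- eps))); split.
  apply: cvg_chain_error; rewrite -(mulr0 (2 / C)); apply: cvgM.
    exact: cvg_cst.
  exact: cvg_powRN.
move=> p n F E alpha _ _ _ q cardE hE.
have q0 : 0 < q := card_field_gt0.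
have qe0 : 0 < q `^ eps by rewrite powR_gt0.
have z0 : 0 < 2 / C * q `^ (- eps) by rewrite !mulr_gt0 ?invr_gt0 ?powR_gt0.
have half_pow l : q `^ (l%:R / 2) = Num.sqrt q ^+ l.
  by rewrite mulrC powRrM powR12_sqrt ?ltW // powR_mulrn // sqrtr_ge0.
have scale X : C * q `^ eps * X <= cardE ->
    2 * X <= 2 / C * q `^ (- eps) * cardE.
  move=> H; have := ler_wpM2l (ltW z0) H; congr (_ <= _).
  by rewrite powRN; field; rewrite !gt_eqF.
(* Hypothesis (i) is the case D = d; in (ii) the nonzero products allow the smaller spectral bound
   with D = d - 1. *)
have [H|[a0 H]] := hE; [apply: (@chains_in_approx _ _ _ _ d)|
  apply: (@chains_in_approx _ _ _ _ d.-1)] => //.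
- exact: spectral_bound_any.
- by rewrite -half_pow natrD; apply: scale.
- by rewrite prednK.
- apply: spectral_bound_nonzero => //; apply/negP => /tnthP[j /esym/eqP].
  exact/negP/a0.
- have -> : (d.-1 + k)%N = (d + k - 1)%N by lia.
  rewrite -half_pow natrB ?natrD; first exact: scale.
  by lia.
Qed.
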